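(* Let $n\ge 2$ be an integer with prime decomposition $n=p_1^{y_1}\cdots p_r^{y_r}$ (the $p_i$ pairwise distinct primes, $y_i\ge 1$) and let $$\Gamma_n=\langle a,t_1,\dots,t_r\mid t_it_j=t_jt_i\ (i\ne j),\ t_iat_i^{-1}=a^{p_i^{y_i}}\ (i=1,\dots,r)\rangle.$$ 1) Every finite index subgroup $H$ of $\Gamma_n$ can be written as $$H=\langle t_1^{k_{11}}t_2^{k_{12}}\cdots t_r^{k_{1r}}a^{l_1},\ t_2^{k_{22}}\cdots t_r^{k_{2r}}a^{l_2},\ \dots,\ t_r^{k_{rr}}a^{l_r},\ a^m\rangle\qquad( * )$$ for some integers $k_{ij}$ ($1\le i\le j\le r$), $l_i$ and $m$ such that $k_{ii}>0$ and $0\le k_{1i},\dots,k_{i-1,i}<k_{ii}$ for every $1\le i\le r$, $m>0$, $\gcd(m,n)=1$ and $H\cap\langle a\rangle=\langle a^m\rangle$. 2) If $H$ is any subgroup of $\Gamma_n$ given by the expression $( * )$ for integers $k_{ij},l_i,m$ such that $k_{ii}>0$ and $0\le k_{1i},\dots,k_{i-1,i}<k_{ii}$ for every $i$, $l_i\in\mathbb{Z}$, $m>0$, $\gcd(m,n)=1$ and $H\cap\langle a\rangle=\langle a^m\rangle$, then $$T=\{t_1^{\beta_1}\cdots t_r^{\beta_r}a^j\mid 0\le\beta_i<k_{ii},\ 0\le j<m\}$$ is a transversal of $H$ in $\Gamma_n$. In particular, the index of $H$ in $\Gamma_n$ is $k_{11}k_{22}\cdots k_{rr}m$, and $H$ has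 finite index in $\Gamma_n$.
   Context: A transversal of $H$ in $\Gamma_n$ is a set containing exactly one element of each right coset $Hg$, $g\in\Gamma_n$ (distinct parameters $(\beta_1,\dots,\beta_r,j)$ give distinct elements of $T$). *)

(* Defs.v *)
From HB Require Import structures.
From mathcomp Require Import all_boot all_order all_algebra.
From mathcomp Require Import all_classical.

Set Implicit Arguments.
Unset Strict Implicit.
Unset Printing Implicit Defensive.

Import Order.TTheory GRing.Theory Num.Theory.
Local Open Scope quotient_scope.
Local Open Scope classical_set_scope.
Local Open Scope group_scope.

(* MathComp has no presented groups: the group < X | R > is the quotient of the
   words over X and formal inverses by the congruence generated by R and free
   cancellation. The letter (x, true) stands for x and (x, false) for its
   inverse; R u v is the relation u = v. *)
Section Presentation.
Variable X : choiceType.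

Definition word := seq (X * bool).

Definition inv_letter (c : X * bool) := (c.1, ~~ c.2).
Definition inv_word (w : word) : word := rev (map inv_letter w).

Variable R : word -> word -> Prop.

Inductive word_eq : word -> word -> Prop :=
| word_eq_refl u : word_eq u u
| word_eq_sym u v : word_eq u v -> word_eq v u
| word_eq_trans u v w : word_eq u v -> word_eq v w -> word_eq u w
| word_eq_cat u u' v v' :
    word_eq u u' -> word_eq v v' -> word_eq (u ++ v) (u' ++ v')
| word_eq_cancel c : word_eq [:: c; inv_letter c] [::]
| word_eq_rel u v : R u v -> word_eq u v.

Definition word_eqb (u v : word) : bool := `[< word_eq u v >].

Fact word_eqb_refl : reflexive word_eqb.
Proof. by move=> u; apply/asboolP; exact: word_eq_refl. Qed.

Fact word_eqb_sym : symmetric word_eqb.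
Proof. by move=> u v; apply/asboolP/asboolP; exact: word_eq_sym. Qed.

Fact word_eqb_trans : transitive word_eqb.
Proof.
by move=> v u w /asboolP uv /asboolP vw; apply/asboolP; exact: word_eq_trans vw.
Qed.

Canonical word_equiv :=
  EquivRel word_eqb word_eqb_refl word_eqb_sym word_eqb_trans.

Definition presented := {eq_quot word_equiv}.
HB.instance Definition _ := Choice.on presented.
HB.instance Definition _ := Quotient.on presented.

Fact presented_eqP (u v : word) :
  word_eq u v <-> \pi_presented u = \pi_presented v.
Proof.
by split=> [uv|/eqquotP/asboolP //]; apply/eqquotP/asboolP.
Qed.

Definition presented_mul (x y : presented) : presented :=
  \pi_presented (repr x ++ repr y).
Definition presented_one : presented := \pi_presented [::].
Definition presented_inv (x : presented) : presented :=
  \pi_presented (inv_word (repr x)).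

Fact word_eq_repr (u : word) : word_eq (repr (\pi_presented u)) u.
Proof. by apply/presented_eqP; rewrite reprK. Qed.

Fact presented_mul_pi (u v : word) :
  presented_mul (\pi_presented u) (\pi_presented v) = \pi_presented (u ++ v).
Proof. by apply/presented_eqP; apply: word_eq_cat; exact: word_eq_repr. Qed.

Fact word_eq_mulwV (u : word) : word_eq (u ++ inv_word u) [::].
Proof.
elim: u => [|c u IHu]; first exact: word_eq_refl.
rewrite /inv_word /= rev_cons -cats1 -cat_cons catA.
apply: word_eq_trans (word_eq_cancel c).
rewrite -(cat1s c) -(cat1s c [:: inv_letter c]) -!catA.
apply: word_eq_cat; first exact: word_eq_refl.
rewrite catA -[X in word_eq _ X]cat0s.
by apply: word_eq_cat; [exact: IHu|exact: word_eq_refl].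
Qed.

Fact inv_wordK : involutive inv_word.
Proof.
move=> u; rewrite /inv_word map_rev revK -map_comp -[RHS]map_id.
by apply: eq_map => -[x b]; rewrite /inv_letter /= negbK.
Qed.

Fact word_eq_mulVw (u : word) : word_eq (inv_word u ++ u) [::].
Proof. by rewrite -{2}(inv_wordK u); exact: word_eq_mulwV. Qed.

Fact presented_mulA : associative presented_mul.
Proof.
move=> x y z; rewrite -[x]reprK -[y]reprK -[z]reprK.
move: (repr x) (repr y) (repr z) => u v w.
by rewrite (presented_mul_pi v w) (presented_mul_pi u v) !presented_mul_pi catA.
Qed.

Fact presented_mul1x : left_id presented_one presented_mul.
Proof. by move=> x; rewrite -[x in LHS]reprK presented_mul_pi reprK. Qed.

Fact presented_mulx1 : right_id presented_one presented_mul.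
Proof. by move=> x; rewrite -[x in LHS]reprK presented_mul_pi cats0 reprK. Qed.

Fact presented_mulVx : left_inverse presented_one presented_inv presented_mul.
Proof.
move=> x; rewrite -{2}[x]reprK [LHS]presented_mul_pi.
by apply/presented_eqP; exact: word_eq_mulVw.
Qed.

Fact presented_mulxV : right_inverse presented_one presented_inv presented_mul.
Proof.
move=> x; rewrite -{1}[x]reprK [LHS]presented_mul_pi.
by apply/presented_eqP; exact: word_eq_mulwV.
Qed.

HB.instance Definition _ := isGroup.Build presented
  presented_mulA presented_mul1x presented_mulx1 presented_mulVx presented_mulxV.

Definition pgen (x : X) : presented := \pi_presented [:: (x, true)].

End Presentation.

(* The generators are indexed by option 'I_r: None is a and Some i is t_i. *)
Inductive Gamma_rel (r : nat) (p y : 'I_r -> nat) :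
    word (option 'I_r) -> word (option 'I_r) -> Prop :=
| Gamma_rel_comm i j : i != j ->
    Gamma_rel p y [:: (Some i, true); (Some j, true)]
                  [:: (Some j, true); (Some i, true)]
| Gamma_rel_conj i :
    Gamma_rel p y [:: (Some i, true); (None, true); (Some i, false)]
                  (nseq (p i ^ y i)%N (None, true)).

Definition Gamma (r : nat) (p y : 'I_r -> nat) : groupType :=
  presented (Gamma_rel p y).

Definition gen_a (r : nat) (p y : 'I_r -> nat) : Gamma p y :=
  pgen (Gamma_rel p y) None.
Definition gen_t (r : nat) (p y : 'I_r -> nat) (i : 'I_r) : Gamma p y :=
  pgen (Gamma_rel p y) (Some i).
Arguments gen_a {r p y}.
Arguments gen_t {r p y} i.

(* MathComp defines x ^+ k in a group only for k : nat. *)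
Definition expgz (G : groupType) (x : G) (k : int) : G :=
  match k with
  | Posz k' => x ^+ k'
  | Negz k' => x ^- k'.+1
  end.
Notation "x ^^ k" := (expgz x k) (at level 29, k at level 28, left associativity)
  : group_scope.

(* MathComp's generated subgroups, cosets and index cover finite groups only. *)
Section Subgroups.
Variable G : groupType.
Implicit Types (A H T : set G) (g : G).

Definition is_subgroup H : Prop := H 1 /\ (forall x y, H x -> H y -> H (x / y)).

Definition gen_subgroup A : set G := smallest is_subgroup A.

Definition right_coset H g : set G := [set h * g | h in H].

Definition right_cosets H : set (set G) := range (right_coset H).

Definition finite_index H : Prop := finite_set (right_cosets H).
Definition has_index H (d : nat) : Prop := (right_cosets H #= `I_d)%card.

Definition transversal_of H T : Prop :=
  forall g, exists! x, (T `&` right_coset H g) x.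

End Subgroups.

(* Indices start at 0, and k i j is used only for i <= j. The group is not
   commutative: big products run over 'I_r in increasing order. *)
Section StarForm.
Variables (r : nat) (p y : 'I_r -> nat).
Local Notation G := (Gamma p y).
Implicit Types (k : 'I_r -> 'I_r -> int) (l b : 'I_r -> int) (m j : int).

Definition star_row k l (i : 'I_r) : G :=
  (\prod_(j < r | (i <= j)%N) gen_t j ^^ k i j) * gen_a ^^ l i.

Definition star_subgroup k l m : set G :=
  gen_subgroup (range (star_row k l) `|` [set gen_a ^^ m]).

Definition star_form (n : nat) (H : set G) k l m : Prop :=
  [/\ H = star_subgroup k l m,
      forall i, (0 < k i i)%R,
      forall i j : 'I_r, (i < j)%N -> (0 <= k i j < k j j)%R &
      [/\ (0 < m)%R, gcdz m n%:Z = 1%Z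
        & H `&` gen_subgroup [set gen_a] = gen_subgroup [set gen_a ^^ m]]].

Definition transversal_elt b j : G :=
  (\prod_(i < r) gen_t i ^^ b i) * gen_a ^^ j.

Definition transversal_param k m b j : Prop :=
  (forall i, 0 <= b i < k i i)%R /\ (0 <= j < m)%R.

Definition transversal_set k m : set G :=
  [set x | exists b j, transversal_param k m b j /\ x = transversal_elt b j].

End StarForm.
Arguments transversal_elt {r} p y b j.
Arguments transversal_set {r} p y k m.

(* Main.v *)
Require Import Defs.
From mathcomp Require Import all_boot all_order all_algebra.
From mathcomp Require Import all_classical.
From mathcomp Require Import ring zify.

(** Write q_i for p_i ^ y_i, so that n is the product of the q_i. The group
    Gamma_n is the semidirect product of Z[1/n] by Z^r: an element g acts on the
    rational line by x |-> q^d x + s, where d = [deg g] is its vector of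
    exponents in the t_i, where q^d = [scale d] is the product of the q_i^d_i,
    and where s = [shift g] lies in Z[1/n]. The pair (d, s) determines g
    ([deg_shift_inj]), because the relations put every element in the form
    tau^-k a^c t^d with tau = t_1 ... t_r ([normal_form]). Identities in Gamma_n
    are therefore identities between such pairs.

    Let K be a subgroup that contains a^m, where gcd(m, n) = 1. If K has
    elements whose degree is large in all coordinates at once, then conjugating
    the powers of a^m by the inverses of these elements divides their shifts by
    arbitrarily high powers of n, so that K contains the normal subgroup
    m Z[1/n] ([Zinv_multiples_sub]). Since m is prime to n, the quotient
    Z[1/n] / m Z[1/n] is Z/m: modulo m Z[1/n], an element of degree d is
    t^d a^j for some 0 <= j < m ([residue]). What is left is a question on
    the lattice of the degrees of K in Z^r, where triangular bases serve.

    For the transversal, Euclidean division by the triangular generators, one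
    coordinate after the other, moves any degree into the box of the b with
    0 <= b_i < k_ii ([echelon_reduce]), and [residue] then yields an element
    t^b a^j of the coset. If t^b a^j and t^b' a^j' lie in the same coset, then
    b - b' is a lattice vector whose coordinates are smaller than the pivots, so
    that b = b' ([minimal_echelon_deg0]); the quotient of the two elements is
    the power of a with exponent q^b (j - j'), hence m divides j - j'
    ([transversal_unique]).

    Conversely, let H have finite index. Each element has a positive power in
    H, so that there are a least m > 0 with a^m in H and, for each i, an element
    of H with least positive i-th degree among those whose earlier degrees
    vanish. Reducing these elements by each other bounds the entries above the
    pivots, and [residue] replaces them by elements t^d a^l. The subgroup K
    generated by these and a^m is contained in H. Given g in H, the coset K g
    contains some t^b a^j in the box; it belongs to H, as does the
    identity, so uniqueness for H forces t^b a^j = 1 and g is in K. That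
    gcd(m, n) = 1 comes from conjugation as above: an element of H with positive
    degrees multiplies shifts by a multiple of n, so that a^(m / gcd(m, n)) is
    in H, against the choice of m unless the gcd is 1. *)

(** * Integer powers, subgroups and cosets in arbitrary groups *)

Section Groups.
Set Implicit Arguments.
Unset Strict Implicit.
Unset Printing Implicit Defensive.
Import Order.TTheory GRing.Theory Num.Theory.
Local Open Scope classical_set_scope.
Local Open Scope ring_scope.
Variable G : groupType.
Implicit Types (x y g : G) (H K : set G) (a b c : int).

Lemma expgz1 x : (x ^^ 1 = x)%g. Proof. exact: expg1. Qed.

Lemma expgz_succ x c : (x ^^ (c + 1)%R = x ^^ c * x)%g.
Proof.
case: c => [c|c]; first by rewrite addrC -intS -expgSr.
have -> : Negz c + 1 = - c%:Z by rewrite NegzE; lia.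
rewrite /= expgS invgM mulgVK.
by case: c => [|c]; rewrite ?invg1.
Qed.

Lemma expgz_addn x c (d : nat) : (x ^^ (c + d%:Z)%R = x ^^ c * x ^+ d)%g.
Proof.
elim: d => [|d IHd]; first by rewrite addr0 mulg1.
by rewrite -addn1 PoszD addrA expgz_succ IHd -mulgA addn1 expgSr.
Qed.

Lemma expgzD x b c : (x ^^ (b + c)%R = x ^^ b * x ^^ c)%g.
Proof.
case: c => c; first exact: expgz_addn.
apply: (canRL (mulgK _)); rewrite -expgz_addn NegzE; congr expgz; lia.
Qed.

Lemma expgzN x c : (x ^^ (- c)%R = (x ^^ c)^-1)%g.
Proof. by apply/eqP; rewrite -mulg_eq1 -expgzD addNr. Qed.

Lemma expgzXn x (k : nat) c : ((x ^+ k) ^^ c = x ^^ (k%:Z * c)%R)%g.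
Proof.
case: c => c; first by rewrite -PoszM; apply/esym/expgnA.
by rewrite NegzE mulrN -PoszM !expgzN; congr (_^-1)%g; apply/esym/expgnA.
Qed.

Lemma intertwine_expgz g x y c :
  (g * x = y * g -> g * x ^^ c = y ^^ c * g)%g.
Proof.
move=> gx; have gX (e : nat) : (g * x ^+ e = y ^+ e * g)%g.
  elim: e => [|e IHe]; first by rewrite mulg1 mul1g.
  by rewrite !expgSr mulgA IHe -!mulgA gx.
case: c => c //=; apply: (canRL (mulKg _)).
by rewrite mulgA -gX mulgK.
Qed.

Lemma commute_expgz x y b c : commute x y -> commute (x ^^ b)%g (y ^^ c)%g.
Proof.
have exp_r g h e : commute g h -> commute g (h ^^ e)%g.
  by move=> gh; case: e => e /=; [|apply: commuteV]; apply: commuteX.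
by move=> /exp_r-/(_ c)/commute_sym/exp_r-/(_ b)/commute_sym.
Qed.

Section Subgroup.
Variable H : set G.
Hypothesis Hsub : is_subgroup H.

Lemma subgroup1 : H 1%g. Proof. by case: Hsub. Qed.

Lemma subgroupF x y : H x -> H y -> H (x / y)%g.
Proof. by case: Hsub => _; apply. Qed.

Lemma subgroupV x : H x -> H (x^-1)%g.
Proof. by rewrite -div1g; apply: subgroupF; apply: subgroup1. Qed.

Lemma subgroupM x y : H x -> H y -> H (x * y)%g.
Proof. by move=> Hx /subgroupV Hy; rewrite -(invgK y); apply: subgroupF. Qed.

Lemma subgroup_expgz x c : H x -> H (x ^^ c)%g.
Proof.
move=> Hx; have HX (e : nat) : H (x ^+ e)%g.
  elim: e => [|e IHe]; first exact: subgroup1.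
  by rewrite expgS; apply: subgroupM.
by case: c => c //=; apply: subgroupV.
Qed.

Lemma mem_right_coset g x : right_coset H g x <-> H (x / g)%g.
Proof.
split=> [[h Hh <-]|Hxg]; first by rewrite mulgK.
by exists (x / g)%g; rewrite // mulgVK.
Qed.

Lemma right_coset_eq x g : H (x / g)%g -> right_coset H x = right_coset H g.
Proof.
move=> Hxg; rewrite predeqE => z; rewrite !mem_right_coset; split=> Hz.
  by rewrite -(mulgVK x z) -mulgA; apply: subgroupM.
by rewrite -(divgKA g z x^-1%g) -[X in (_ * X)%g]invgF; apply: subgroupF.
Qed.

(** Two of the cosets H g^0, H g^1, ... coincide. *)
Lemma finite_index_exp g :
  finite_index H -> exists2 e : nat, (0 < e)%N & H (g ^+ e)%g.
Proof.
move=> finH; apply: contrapT => noexp.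
have inj : {in [set: nat] &, injective (fun e => right_coset H (g ^+ e)%g)}.
  move=> i j _ _ /= eq_ij; wlog lt_ij : i j eq_ij / (i < j)%N => [wlogH|].
    by case: (ltngtP i j) => // lt_ij; [|apply/esym]; apply: wlogH.
  have : right_coset H (g ^+ j)%g (g ^+ j)%g.
    by apply/mem_right_coset; rewrite mulgV; apply: subgroup1.
  rewrite -eq_ij mem_right_coset -expgnFr; last exact: ltnW.
  by move=> Hg; case: noexp; exists (j - i)%N; rewrite ?subn_gt0.
apply: infinite_nat; rewrite -(eq_finite_set (inj_card_eq inj)).
by apply: sub_finite_set finH => _ [e _ <-]; exists (g ^+ e)%g.
Qed.

End Subgroup.

Lemma gen_subgroupP (A : set G) : is_subgroup (gen_subgroup A).
Proof.
split=> [K [[K1 _] _] //|x y Ax Ay K [Ksub AK]].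
by apply: subgroupF; [|apply: Ax|apply: Ay].
Qed.

Lemma sub_gen_subgroup (A : set G) : A `<=` gen_subgroup A.
Proof. by move=> x Ax K [_ AK]; apply: AK. Qed.

Lemma gen_subgroup_min (A K : set G) :
  is_subgroup K -> A `<=` K -> gen_subgroup A `<=` K.
Proof. by move=> Ksub AK x; apply. Qed.

Lemma gen_subgroup_set1 x : gen_subgroup [set x] = range (expgz x).
Proof.
rewrite eqEsubset; split=> [|_ [c _ <-]].
  apply: gen_subgroup_min => [|_ ->]; last by exists 1; rewrite ?expgz1.
  split=> [|_ _ [b _ <-] [c _ <-]]; first by exists 0.
  by exists (b - c); rewrite ?expgzD ?expgzN.
by apply: (subgroup_expgz (gen_subgroupP _)); apply: sub_gen_subgroup.
Qed.

End Groups.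

(** * The affine action on the rational line *)

Section SolvableBS.
Import Order.TTheory GRing.Theory Num.Theory.
Set Implicit Arguments.
Unset Strict Implicit.
Unset Printing Implicit Defensive.
Local Open Scope classical_set_scope.
Local Open Scope ring_scope.
Variables (r : nat) (p y : 'I_r -> nat).
Hypothesis q_gt0 : forall i, (0 < p i ^ y i)%N.
Local Notation q i := (p i ^ y i)%N.
Local Notation n := (\prod_(i < r) q i)%N.
Local Notation G := (Gamma p y).
Local Notation a := (@gen_a r p y).
Local Notation t := (@gen_t r p y).
Implicit Types (d e : 'I_r -> int) (g h : G) (w : word (option 'I_r)).

Definition scale d : rat := \prod_i (q i)%:R ^ d i.

Lemma natr_q_neq0 i : (q i)%:R != 0 :> rat.
Proof. by rewrite pnatr_eq0 -lt0n. Qed.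

Lemma scale_neq0 d : scale d != 0.
Proof. by apply/prodf_neq0 => i _; rewrite expfz_neq0 // natr_q_neq0. Qed.

Lemma scale0 : scale 0 = 1.
Proof. by apply: big1. Qed.

Lemma scaleD d e : scale (d + e) = scale d * scale e.
Proof.
rewrite -big_split; apply: eq_bigr => i _.
by rewrite /= -expfzDr ?natr_q_neq0.
Qed.

Lemma scaleN d : scale (- d) = (scale d)^-1.
Proof.
apply: (mulfI (scale_neq0 d)); rewrite -scaleD subrr scale0.
by rewrite mulfV ?scale_neq0.
Qed.

Lemma scale_nat d :
  (forall i, 0 <= d i) -> scale d = (\prod_i q i ^ `|d i|)%N%:R.
Proof.
move=> d_ge0; rewrite natr_prod; apply: eq_bigr => i _.
by rewrite [RHS]natrX -{1}(gez0_abs (d_ge0 i)).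
Qed.

Lemma scale_delta i : scale (fun j => (j == i)%:Z) = (q i)%:R.
Proof.
rewrite /scale (bigD1 i) //= eqxx expr1z big1 ?mulr1 // => j /negbTE ->.
by rewrite expr0z.
Qed.

Lemma scale_cst (k : nat) : scale (fun=> k%:Z) = n%:R ^+ k.
Proof.
rewrite scale_nat // -natrX; congr (_%:R).
by rewrite (big_morph (fun x => x ^ k)%N (fun x z => expnMn x z k) (exp1n k)).
Qed.

(** [wdeg w] and [wshift w] describe the affine map x |-> q^d x + s obtained by
    composing x + 1 for each letter a of the word, q_i x for each letter t_i and
    the inverse maps for the inverse letters. *)
Definition wdeg w (i : 'I_r) : int :=
  \sum_(c <- w | c.1 == Some i) (if c.2 then 1 else -1).

Fixpoint wshift w : rat :=
  if w is c :: w' then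
    (if c.1 is None then if c.2 then 1 else -1 else 0)
    + scale (wdeg [:: c]) * wshift w'
  else 0.

Lemma wdeg_cat u v : wdeg (u ++ v) = wdeg u + wdeg v.
Proof. by apply/funext => i; rewrite /wdeg big_cat. Qed.

Lemma wshift_cat u v : wshift (u ++ v) = wshift u + scale (wdeg u) * wshift v.
Proof.
elim: u => [|c u IHu].
  rewrite add0r (_ : wdeg [::] = 0) ?scale0 ?mul1r //.
  by apply/funext => i; rewrite /wdeg big_nil.
rewrite cat_cons /= IHu mulrDr addrA -(cat1s c u) wdeg_cat scaleD.
by rewrite mulrA.
Qed.

Lemma wdeg_a (b : bool) : wdeg [:: (None, b)] = 0.
Proof. by apply/funext => i; rewrite /wdeg big_cons big_nil. Qed.

Lemma wdeg_t i : wdeg [:: (Some i, true)] = fun j => (j == i)%:Z.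
Proof.
apply/funext => j; rewrite /wdeg big_cons big_nil /= addr0 (inj_eq Some_inj).
by rewrite eq_sym; case: eqP.
Qed.

Lemma wshift_nseq (k : nat) : wshift (nseq k (None, true)) = k%:R.
Proof. by elim: k => //= k ->; rewrite wdeg_a scale0 mul1r -natr1 addrC. Qed.

Lemma wdeg_nseq (k : nat) : wdeg (nseq k (None, true)) = 0.
Proof.
elim: k => [|k IHk]; apply/funext => i; rewrite /wdeg ?big_nil // big_cons.
exact: (congr1 (@^~ i) IHk).
Qed.

(** The defining relations hold between affine maps: multiplications by q_i and
    q_j commute, and conjugating x + 1 by q_i x gives x + q_i. Thus [wdeg] and
    [wshift] descend to the group. *)
Lemma word_eq_inv u v :
  word_eq (Gamma_rel p y) u v -> wdeg u = wdeg v /\ wshift u = wshift v.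
Proof.
elim=> {u v}[//|u v _ [-> ->] //|u v w _ [-> ->] _ [-> ->] //|||].
- move=> u u' v v' _ [du vu] _ [dv vv].
  by rewrite !wdeg_cat !wshift_cat du vu dv vv.
- move=> c; have cN : wdeg [:: c; inv_letter c] = 0.
    apply/funext => i; rewrite /wdeg !big_cons big_nil /= addr0.
    by case: eqP => // _; case: c.2; rewrite ?subrr ?addNr.
  split; first by rewrite cN; apply/funext => i; rewrite /wdeg big_nil.
  case: c cN => -[i|] b cN /=; first by rewrite !mulr0 !add0r ?mulr0.
  by rewrite mulr0 addr0 wdeg_a scale0 mul1r; case: b {cN};
    rewrite ?subrr ?addNr.
move=> u v; case=> [i j _|i].
  split; last by rewrite /= !mulr0 !addr0 ?mulr0.
  by rewrite -cat1s wdeg_cat addrC -wdeg_cat.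
rewrite wshift_nseq wdeg_nseq; split.
  apply/funext => j; rewrite /wdeg !big_cons big_nil /=.
  by case: eqP => // _; rewrite addr0 subrr.
by rewrite /= wdeg_t scale_delta !mulr0 !addr0 add0r mulr1.
Qed.

Definition deg g := wdeg (repr g).
Definition shift g := wshift (repr g).

Lemma deg_pi w : deg (\pi_(presented (Gamma_rel p y)) w)%qT = wdeg w.
Proof. by case: (word_eq_inv (word_eq_repr (Gamma_rel p y) w)). Qed.

Lemma shift_pi w : shift (\pi_(presented (Gamma_rel p y)) w)%qT = wshift w.
Proof. by case: (word_eq_inv (word_eq_repr (Gamma_rel p y) w)). Qed.

Lemma degM g h : deg (g * h)%g = deg g + deg h.
Proof. by rewrite [LHS]deg_pi wdeg_cat. Qed.

Lemma degM_at g h i : deg (g * h)%g i = deg g i + deg h i.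
Proof. by rewrite degM. Qed.

Lemma shiftM g h : shift (g * h)%g = shift g + scale (deg g) * shift h.
Proof. by rewrite [LHS]shift_pi wshift_cat. Qed.

Lemma deg1 : deg 1%g = 0.
Proof. by rewrite [LHS]deg_pi; apply/funext => i; rewrite /wdeg big_nil. Qed.

Lemma shift1 : shift 1%g = 0. Proof. exact: shift_pi. Qed.

Lemma degV g : deg (g^-1)%g = - deg g.
Proof. by apply/eqP; rewrite -addr_eq0 -degM mulVg deg1. Qed.

Lemma shiftV g : shift (g^-1)%g = - (scale (- deg g) * shift g).
Proof.
by apply/eqP; rewrite -addr_eq0 -degV -shiftM mulVg shift1.
Qed.

Lemma degV_at g i : deg (g^-1)%g i = - deg g i.
Proof. by rewrite degV. Qed.

Lemma degF g h : deg (g / h)%g = deg g - deg h.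
Proof. by rewrite degM degV. Qed.

Lemma shiftF g h : deg g = deg h -> shift (g / h)%g = shift g - shift h.
Proof.
move=> gh; rewrite shiftM shiftV gh mulrN mulrA -scaleD subrr scale0.
by rewrite mul1r.
Qed.

Lemma deg_a : deg a = 0. Proof. by rewrite [LHS]deg_pi wdeg_a. Qed.
Lemma shift_a : shift a = 1.
Proof. by rewrite [LHS]shift_pi /= mulr0 addr0. Qed.
Lemma deg_t i : deg (t i) = fun j => (j == i)%:Z.
Proof. by rewrite [LHS]deg_pi wdeg_t. Qed.
Lemma shift_t i : shift (t i) = 0.
Proof. by rewrite [LHS]shift_pi /= mulr0 addr0. Qed.

Lemma deg_expgz g (c : int) i : deg (g ^^ c)%g i = c * deg g i.
Proof.
have degX (k : nat) : deg (g ^+ k)%g i = k%:Z * deg g i.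
  elim: k => [|k IHk]; first by rewrite deg1 mul0r.
  by rewrite expgS degM intS mulrDl mul1r -IHk.
case: c => c /=; first exact: degX.
by rewrite degV NegzE mulNr -degX.
Qed.

Lemma shift_expgz g (c : int) : deg g = 0 -> shift (g ^^ c)%g = c%:~R * shift g.
Proof.
move=> g0.
have shiftX (k : nat) : shift (g ^+ k)%g = k%:R * shift g.
  elim: k => [|k IHk]; first by rewrite shift1 mul0r.
  by rewrite expgS shiftM g0 scale0 mul1r IHk -nat1r mulrDl mul1r.
case: c => c /=; first exact: shiftX.
rewrite shiftV shiftX (_ : deg (g ^+ c.+1)%g = 0) ?oppr0 ?scale0 ?mul1r.
  by rewrite NegzE rmorphN mulNr.
by apply/funext => i; have := deg_expgz g c.+1 i; rewrite g0 mulr0.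
Qed.

Lemma deg_ax (c : int) : deg (a ^^ c)%g = 0.
Proof. by apply/funext => i; rewrite deg_expgz deg_a mulr0. Qed.

Lemma shift_ax (c : int) : shift (a ^^ c)%g = c%:~R.
Proof. by rewrite shift_expgz ?deg_a // shift_a mulr1. Qed.

Definition tpow d : G := (\prod_(i < r) t i ^^ d i)%g.

Lemma deg_tpow d : deg (tpow d) = d.
Proof.
apply/funext => j.
have deg_at0 : deg 1%g j = 0 by rewrite deg1.
rewrite /tpow (big_morph (fun g => deg g j) (fun g h => degM_at g h j) deg_at0).
rewrite (bigD1 j) //= big1 ?addr0 => [|i /negbTE ij].
  by rewrite deg_expgz deg_t eqxx mulr1.
by rewrite deg_expgz deg_t eq_sym ij mulr0.
Qed.

Lemma shift0_subgroup : is_subgroup [set g | shift g = 0].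
Proof.
split=> [|g h /= g0 h0]; first exact: shift1.
by rewrite shiftM shiftV g0 h0 mulr0 oppr0 mulr0 addr0.
Qed.

Lemma shift_tpow d : shift (tpow d) = 0.
Proof.
apply: (big_ind (fun g => shift g = 0)) => [|g h|i _]; first exact: shift1.
  exact: (subgroupM shift0_subgroup).
exact: (subgroup_expgz shift0_subgroup _ (shift_t i)).
Qed.

Lemma deg_telt d (c : int) : deg (transversal_elt p y d c) = d.
Proof. by rewrite degM deg_tpow deg_ax addr0. Qed.

Lemma shift_telt d (c : int) :
  shift (transversal_elt p y d c) = scale d * c%:~R.
Proof. by rewrite shiftM shift_tpow deg_tpow shift_ax add0r. Qed.

(** * Normal forms, and faithfulness of the action *)

Lemma presented_genV (x : option 'I_r) :
  ((pgen (Gamma_rel p y) x)^-1)%g =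
  (\pi_(presented (Gamma_rel p y)) [:: (x, false)])%qT.
Proof.
apply: mulg1_eq; rewrite [LHS]presented_mul_pi.
by apply/presented_eqP; apply: (word_eq_cancel _ (x, true)).
Qed.

Lemma commute_t i j : commute (t i) (t j).
Proof.
have [->|ij] := eqVneq i j; first exact: commute_refl.
rewrite /commute [LHS]presented_mul_pi [RHS]presented_mul_pi.
by apply/presented_eqP/word_eq_rel/Gamma_rel_comm.
Qed.

Lemma pi_nseq_a (k : nat) :
  (\pi_(presented (Gamma_rel p y)) (nseq k (None, true)))%qT = (a ^+ k)%g.
Proof.
by elim: k => // k IHk; rewrite expgS -IHk [RHS]presented_mul_pi.
Qed.

Lemma mul_t_a i : (t i * a = a ^+ q i * t i)%g.
Proof.
rewrite -[LHS](mulgVK (t i)); congr (_ * _)%g.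
rewrite presented_genV -pi_nseq_a.
rewrite [(t i * a)%g]presented_mul_pi [LHS]presented_mul_pi.
by apply/presented_eqP/word_eq_rel/Gamma_rel_conj.
Qed.

(** Exponents of the t_i are nonnegative here because t_i^-1 a^c is of the form
    a^c' t_i^-1 only if q_i divides c. *)
Lemma mul_tpow_ax d (c : int) : (forall i, 0 <= d i) ->
  (tpow d * a ^^ c = a ^^ ((\prod_i q i ^ `|d i|)%N%:Z * c)%R * tpow d)%g.
Proof.
move=> d_ge0; rewrite /tpow.
elim: (index_enum _) c => [|i s IHs] c;
  first by rewrite !big_nil mul1g mulg1 mul1r.
rewrite !big_cons -mulgA IHs mulgA PoszM -mulrA; set b := (_%:Z * c).
rewrite mulgA; congr (_ * _)%g; case: (d i) (d_ge0 i) => // k _ {IHs}.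
elim: k b => [|k IHk] b; first by rewrite mul1r mul1g mulg1.
rewrite /= expgSr -mulgA (intertwine_expgz _ (mul_t_a i)) expgzXn mulgA IHk.
by rewrite -mulgA -expgSr mulrA -PoszM expnSr.
Qed.

Lemma tpowD d e : tpow (d + e) = (tpow d * tpow e)%g.
Proof.
rewrite -prodgM_commute => [|i j _ _]; last exact/commute_expgz/commute_t.
by apply: eq_bigr => i _; rewrite -expgzD.
Qed.

Lemma tpow0 : tpow 0 = 1%g.
Proof. by apply: big1. Qed.

Lemma tpow_delta i : tpow (fun j => (j == i)%:Z) = t i.
Proof.
transitivity (\prod_(j < r | j == i) t j)%g; last exact: big_pred1_eq.
rewrite [RHS]big_mkcond.
by apply: eq_bigr => j _; case: eqP; rewrite ?expgz1.
Qed.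

(** The form is stable under left multiplication by each letter: a letter
    a is carried through tau^-k into a power of a, and for a letter t_i or its
    inverse one more factor tau^-1 is split off, which leaves tau t_i or
    tau t_i^-1, whose exponents are nonnegative, to be moved past a^c. *)
Lemma normal_form g : exists (k : nat) (c : int) d,
  (g = tpow (fun=> - k%:Z) * a ^^ c * tpow d)%g.
Proof.
have mul_a (b : int) (k : nat) (c : int) d :
    (a ^^ b * (tpow (fun=> - k%:Z) * a ^^ c * tpow d) =
     tpow (fun=> - k%:Z) * a ^^ ((\prod_i q i ^ k)%N%:Z * b + c) * tpow d)%g.
  rewrite expgzD !mulgA; congr (_ * _ * _)%g.
  have tpowK : (tpow (fun=> (- k%:Z)) * tpow (fun=> k%:Z) = 1)%g.
    by rewrite -tpowD -[RHS]tpow0; congr tpow; apply/funext => i; apply: addNr.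
  rewrite -[LHS]mul1g -tpowK -!mulgA; congr (_ * _)%g.
  rewrite mulgA mul_tpow_ax // -mulgA -tpowD.
  rewrite (_ : _ + _ = 0) ?tpow0 ?mulg1 //.
  by apply/funext => i; apply: subrr.
have mul_t e (k : nat) (c : int) d : (forall i, 0 <= 1 + e i) -> exists c' d',
    (tpow e * (tpow (fun=> - k%:Z) * a ^^ c * tpow d) =
     tpow (fun=> - k.+1%:Z) * a ^^ c' * tpow d')%g.
  move=> e_ge; pose e1 i := 1 + e i.
  exists ((\prod_i q i ^ `|e1 i|)%N%:Z * c), (e1 + d).
  rewrite tpowD !mulgA -tpowD (_ : e + _ = (fun=> - k.+1%:Z) + e1).
    by rewrite tpowD -[in LHS](mulgA _ _ (a ^^ c)%g) (mul_tpow_ax c e_ge)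
      !mulgA.
  by apply/funext => i; change (e i - k%:Z = - k.+1%:Z + (1 + e i)); lia.
rewrite -[g]reprK; elim: (repr g) => {g} [|[x b] w [k [c [d IHw]]]].
  by exists 0%N, 0, 0; rewrite tpow0 !mulg1.
pose s : int := if b then 1 else -1.
have -> : (\pi_(presented (Gamma_rel p y)) ((x, b) :: w))%qT =
  (pgen (Gamma_rel p y) x ^^ s * (\pi_(presented (Gamma_rel p y)) w)%qT)%g.
  rewrite /s; case: b {s}; rewrite ?expgzN expgz1 ?presented_genV.
    by rewrite [RHS]presented_mul_pi.
  by rewrite [RHS]presented_mul_pi.
rewrite IHw; case: x => [i|].
  pose e (j : 'I_r) := s * (j == i)%:Z.
  have e_ge j : 0 <= 1 + e j.
    by rewrite /e /s; case: b {s e}; case: eqP.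
  have -> : (pgen (Gamma_rel p y) (Some i) ^^ s = tpow e)%g.
    rewrite -[pgen _ _](tpow_delta i) /e /s; case: b {s e e_ge}.
      by rewrite expgz1; congr tpow; apply/funext => j; rewrite mul1r.
    rewrite expgzN expgz1; apply: mulg1_eq; rewrite -tpowD -[RHS]tpow0.
    congr tpow; apply/funext => j.
    by change ((j == i)%:Z + -1 * (j == i)%:Z = 0); rewrite mulN1r subrr.
  have [c' [d' ->]] := mul_t e k c d e_ge.
  by exists k.+1, c', d'.
by rewrite mul_a; exists k; eexists; exists d.
Qed.

(** In the normal form of an element with trivial image, c is the shift up to a
    nonzero factor and the two powers of the t_i are inverse to each other. *)
Lemma deg_shift_inj g h : deg g = deg h -> shift g = shift h -> g = h.
Proof.
move=> dgh vgh; apply: divg1_eq.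
have := degF g h; have := shiftF dgh; rewrite dgh vgh !subrr.
have [k [c [d ->]]] := normal_form (g / h)%g.
rewrite !shiftM !degM !deg_tpow deg_ax !shift_tpow shift_ax mulr0 addr0 add0r
  addr0.
move=> /eqP; rewrite mulf_eq0 (negbTE (scale_neq0 _)) intr_eq0 => /eqP ->.
by rewrite mulg1 -tpowD => ->; apply: tpow0.
Qed.

(** * The translations by multiples of m in Z[1/n] *)

(** Membership in the subring Z[1/n] of the rationals. *)
Definition in_Zinv (x : rat) :=
  exists (k : nat) (c : int), n%:R ^+ k * x = c%:~R.

Lemma in_Zinv_shift g : in_Zinv (shift g).
Proof.
have [k [c [d ->]]] := normal_form g; exists k, c.
rewrite !shiftM !shift_tpow shift_ax mulr0 addr0 add0r deg_tpow -scale_cst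
  mulrA.
by rewrite -scaleD (_ : _ + _ = 0) ?scale0 ?mul1r //; apply/funext => i;
  apply: subrr.
Qed.

Lemma in_Zinv_mul x z : in_Zinv x -> in_Zinv z -> in_Zinv (x * z).
Proof.
move=> [k [c xc]] [l [b zb]]; exists (k + l)%N, (c * b).
by rewrite rmorphM /= -xc -zb exprD mulrACA.
Qed.

Lemma in_Zinv_scale d : in_Zinv (scale d).
Proof.
by have := in_Zinv_shift (tpow d * a)%g;
  rewrite shiftM shift_tpow deg_tpow shift_a add0r mulr1.
Qed.

(** High powers of all the q_i at once clear the denominator, which divides a
    power of n. *)
Lemma in_Zinv_clear x : in_Zinv x ->
  exists k : nat, forall d, (forall i, k%:Z <= d i) ->
  exists c : int, scale d * x = c%:~R.
Proof.
move=> [k [c xc]]; exists k => d d_ge.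
have -> : d = (fun i => d i - k%:Z) + (fun=> k%:Z).
  by apply/funext => i; apply/esym; apply: subrK.
rewrite scaleD scale_cst -mulrA xc scale_nat => [|i]; last by rewrite subr_ge0.
by eexists ((_ : nat)%:Z * c); rewrite rmorphM.
Qed.

Lemma expgz_a_mul (b c : int) : ((a ^^ b) ^^ c = a ^^ (b * c)%R)%g.
Proof.
apply: deg_shift_inj.
  by rewrite deg_ax; apply/funext => i; rewrite deg_expgz deg_ax mulr0.
by rewrite shift_expgz ?deg_ax // !shift_ax rmorphM mulrC.
Qed.

Definition Zinv_multiples (m : int) : set G :=
  [set g | deg g = 0 /\ exists2 x, in_Zinv x & shift g = m%:~R * x].

Definition deg_unbounded (K : set G) :=
  forall k : nat, exists2 w, K w & forall i, k%:Z <= deg w i.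

(** For w in K of large degree, w conjugates the given translation by m x to
    the translation by m (q^deg w x), where q^deg w x is an integer: this is a
    power of a^m. *)
Lemma Zinv_multiples_sub (K : set G) (m : int) :
  is_subgroup K -> K (a ^^ m)%g -> deg_unbounded K -> Zinv_multiples m `<=` K.
Proof.
move=> Ksub Kam Klarge g [g0 [x /in_Zinv_clear[k kx] vg]].
have [w Kw /kx[c cx]] := Klarge k.
have wg : (w * g = a ^^ (m * c)%R * w)%g.
  apply: deg_shift_inj; first by rewrite !degM g0 deg_ax addr0 add0r.
  rewrite !shiftM deg_ax scale0 mul1r vg shift_ax mulrCA cx.
  by rewrite addrC rmorphM.
rewrite -(mulKg w g) wg -expgz_a_mul; apply: (subgroupM Ksub);
  first exact: subgroupV.
by apply: (subgroupM Ksub) => //; apply: subgroup_expgz.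
Qed.

(** Since n is invertible modulo m, the inclusion of Z in Z[1/n] induces a
    surjection of Z/m onto Z[1/n] / m Z[1/n]. *)
Lemma in_Zinv_mod (m : int) x : 0 < m -> coprimez m n%:Z -> in_Zinv x ->
  exists j : int, 0 <= j < m /\ exists2 z, in_Zinv z & j%:~R - x = m%:~R * z.
Proof.
move=> m_gt0 co_mn [k [c xc]].
have nk0 : n%:R ^+ k != 0 :> rat by rewrite -scale_cst scale_neq0.
have /coprimezP[[u v] /= uv] : coprimez m (n%:Z ^+ k) by apply: coprimezXr.
(* v inverts n^k modulo m, so c v is the residue of x = c / n^k. *)
exists ((c * v) %% m)%Z; rewrite modz_ge0 ?gt_eqF //= ltz_pmod //; split=> //.
pose b := - u * c - (c * v %/ m)%Z * n%:Z ^+ k.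
exists (b%:~R / n%:R ^+ k); first by exists k, b; rewrite mulrC mulfVK.
apply: (mulfI nk0); rewrite mulrBr xc.
rewrite [RHS](_ : _ = (m * b)%:~R); last first.
  by rewrite rmorphM /= mulrCA (mulrC (n%:R ^+ k)) mulfVK.
have -> : n%:R ^+ k = (n%:Z ^+ k)%:~R :> rat by rewrite rmorphXn.
rewrite -rmorphM -rmorphB; congr (_%:~R); rewrite /b.
have := divz_eq (c * v) m; set s := (_ %/ _)%Z; set j := (_ %% _)%Z.
move: (n%:Z ^+ k) uv => e uv cv.
have -> : j = c * v - s * m by rewrite cv addrC addKr.
have cuv : c * (u * m + v * e) = c by rewrite uv mulr1.
rewrite -[X in _ - X = _]cuv; ring.
Qed.

(** Multiplying g by t^-d on the left, where d is its degree, gives a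
    translation, to which [in_Zinv_mod] applies. *)
Lemma residue (m : int) g : 0 < m -> coprimez m n%:Z ->
  exists j : int, 0 <= j < m /\
    Zinv_multiples m (transversal_elt p y (deg g) j / g)%g.
Proof.
move=> m_gt0 co_mn.
have fg : in_Zinv (scale (- deg g) * shift g).
  by apply: in_Zinv_mul; [apply: in_Zinv_scale|apply: in_Zinv_shift].
have [j [j_lt [z fz jz]]] := in_Zinv_mod m_gt0 co_mn fg.
exists j; split=> //; split; first by rewrite degF deg_telt subrr.
exists (scale (deg g) * z).
  by apply: in_Zinv_mul => //; apply: in_Zinv_scale.
rewrite shiftF ?deg_telt // shift_telt mulrCA -jz mulrBr mulrA -scaleD.
by rewrite subrr scale0 mul1r.
Qed.

(** * Triangular families and their degrees *)

Definition echelon (K : set G) (h : 'I_r -> G) := forall i,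
  [/\ K (h i), forall j : 'I_r, (j < i)%N -> deg (h i) j = 0 & 0 < deg (h i) i].

(** Division by the pivots in increasing order of the coordinates: subtracting
    a multiple of the row i leaves the coordinates before i as they are. The
    offset [s] lets the rows after i be used to reduce row i itself. *)
Lemma echelon_reduce K (h : 'I_r -> G) g (s : nat) :
  is_subgroup K -> echelon K h ->
  exists w : G, [/\ K w, forall j : 'I_r, (j < s)%N -> deg w j = 0 &
    forall j : 'I_r, (s <= j)%N -> 0 <= deg (w * g)%g j < deg (h j) j].
Proof.
move=> Ksub hK.
suff /(_ r)[w [Kw w0 wr]] : forall b : nat,
  exists w : G, [/\ K w, forall j : 'I_r, (j < s)%N -> deg w j = 0 &
    forall j : 'I_r, (s <= j)%N -> (j < b)%N ->
      0 <= deg (w * g)%g j < deg (h j) j].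
  by exists w; split=> // j sj; apply: wr.
elim=> [|b [w [Kw w0 wb]]].
  by exists 1%g; split=> // [|j _]; [exact: subgroup1|rewrite deg1].
have [r_le|b_lt] := leqP r b.
  by exists w; split=> // j sj _; apply: wb; rewrite // (leq_trans (ltn_ord j)).
have [b_lt_s|s_le] := ltnP b s.
  exists w; split=> // j sj; rewrite ltnS => jb.
  by have := leq_trans b_lt_s (leq_trans sj jb); rewrite ltnn.
pose i := Ordinal b_lt; have [Khi hi0 hi_gt0] := hK i.
pose c := (deg (w * g)%g i %/ deg (h i) i)%Z.
exists (h i ^^ (- c) * w)%g.
have degj (j : 'I_r) :
    deg (h i ^^ (- c) * w * g)%g j = deg (w * g)%g j - c * deg (h i) j.
  by rewrite -mulgA [LHS]degM_at deg_expgz mulNr addrC.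
split=> [|j js|j sj].
- by apply: (subgroupM Ksub) => //; apply: subgroup_expgz.
- by rewrite degM_at w0 // deg_expgz hi0 ?mulr0 // (leq_trans js).
rewrite ltnS leq_eqVlt => /orP[/eqP jb|jb]; last first.
  by rewrite degj hi0 // mulr0 subr0 wb.
have -> : j = i by apply: val_inj.
have -> : deg (h i ^^ (- c) * w * g)%g i = (deg (w * g)%g i %% deg (h i) i)%Z.
  by rewrite degj /modz.
by rewrite modz_ge0 ?gt_eqF // ltz_pmod.
Qed.

(** Reducing the element of degree (-k, ..., -k) to nonnegative degrees takes an
    element of K with all degrees at least k. *)
Lemma echelon_unbounded K (h : 'I_r -> G) :
  is_subgroup K -> echelon K h -> deg_unbounded K.
Proof.
move=> Ksub hK k.
have [w [Kw _ wr]] := echelon_reduce (tpow (fun=> k%:Z))^-1%g 0 Ksub hK.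
exists w => // i; have /andP[] := wr i isT.
by rewrite degM_at degV_at deg_tpow subr_ge0.
Qed.

(** Minimality of the pivots says that the family is a triangular basis of the
    lattice of degrees of [K]. *)
Definition minimal_echelon (K : set G) (h : 'I_r -> G) := echelon K h /\
  forall g (i : 'I_r), K g -> (forall j : 'I_r, (j < i)%N -> deg g j = 0) ->
    0 < deg g i -> deg (h i) i <= deg g i.

(** The first nonzero coordinate of the degree of [g], or of its inverse, would
    be at least the pivot. *)
Lemma minimal_echelon_deg0 K (h : 'I_r -> G) g :
  is_subgroup K -> minimal_echelon K h ->
  K g -> (forall i, `|deg g i| < deg (h i) i) -> deg g = 0.
Proof.
move=> Ksub [_ hmin] Kg g_lt.
suff g_eq0 b (i : 'I_r) : (i < b)%N -> deg g i = 0.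
  by apply/funext => i; apply: (g_eq0 r).
elim: b i => // b IHb i; rewrite ltnS => ib.
have g0 (j : 'I_r) : (j < i)%N -> deg g j = 0.
  by move=> ji; apply: IHb; apply: leq_trans ib.
have [gi|gi|//] := ltrgtP (deg g i) 0.
  have := hmin (g^-1)%g i (subgroupV Ksub Kg).
  have gV0 (j : 'I_r) : (j < i)%N -> deg (g^-1)%g j = 0.
    by rewrite degV_at => /g0 ->; rewrite oppr0.
  move=> /(_ gV0); rewrite degV_at oppr_gt0 gi leNgt -ltr0_norm // g_lt.
  by move=> /(_ isT).
have := hmin g i Kg g0 gi.
by rewrite leNgt -[deg g i]gtr0_norm // g_lt.
Qed.

(** The shift of a^c is c, so that a has infinite order. *)
Lemma cap_cycle_aP (H : set G) (m : int) :
  H `&` gen_subgroup [set a] = gen_subgroup [set a ^^ m]%g <->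
  (forall c : int, H (a ^^ c)%g <-> (m %| c)%Z).
Proof.
have pow_am (c : int) : range (expgz (a ^^ m)%g) (a ^^ c)%g <-> (m %| c)%Z.
  split=> [[e _ /(congr1 shift)]|/dvdzP[e ->]].
    by rewrite expgz_a_mul !shift_ax => /intr_inj <-; apply: dvdz_mulr.
  by exists e => //; rewrite expgz_a_mul mulrC.
rewrite !gen_subgroup_set1; split=> [Ham c|HaP].
  by rewrite -pow_am -Ham; split=> [Hc|[]//]; split=> //; exists c.
rewrite predeqE => g; split=> [[Hg [c _ gc]]|gm].
  by move: Hg; rewrite -gc HaP pow_am.
have [e _ ge] := gm; move: ge gm; rewrite expgz_a_mul => <-.
by rewrite pow_am -HaP => Hg; split=> //; exists (m * e).
Qed.

(** * Coset representatives *)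

Section Transversal.
Variables (K : set G) (h : 'I_r -> G) (k : 'I_r -> 'I_r -> int) (m : int).
Hypotheses (Ksub : is_subgroup K) (kE : forall i, deg (h i) i = k i i).
Hypothesis co_mn : coprimez m n%:Z.

(** Division by the rows brings the degree of g into the box; a translation in
    m Z[1/n], which lies in K, then corrects the shift. *)
Lemma transversal_exists g : echelon K h -> 0 < m -> K (a ^^ m)%g ->
  exists b j, transversal_param k m b j /\ K (transversal_elt p y b j / g)%g.
Proof.
move=> hK m_gt0 Kam.
have [w [Kw _ wg]] := echelon_reduce g 0 Ksub hK.
have MK := Zinv_multiples_sub Ksub Kam (echelon_unbounded Ksub hK).
have [j [j_lt /MK Kj]] := residue (w * g)%g m_gt0 co_mn.
exists (deg (w * g)%g), j; split; first by split=> // i; rewrite -kE; apply: wg.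
by rewrite -(mulgVK w (_ / g)%g) -(mulgA _ (g^-1)%g) -invgM; apply: subgroupM.
Qed.

(** When b = b', the quotient of the two elements is a translation by the
    integer q^b (j - j'), hence a power of a, and q^b is prime to m. *)
Lemma transversal_unique b b' (j j' : int) : minimal_echelon K h ->
    (forall c : int, K (a ^^ c)%g <-> (m %| c)%Z) ->
    transversal_param k m b j -> transversal_param k m b' j' ->
    K (transversal_elt p y b j / transversal_elt p y b' j')%g ->
  b = b' /\ j = j'.
Proof.
move=> hK aKP [b_lt /andP[j_ge j_lt]] [b'_lt /andP[j'_ge j'_lt]] Kbb'.
have bb' : b = b'.
  apply/eqP; rewrite -subr_eq0; apply/eqP.
  have := minimal_echelon_deg0 Ksub hK Kbb'; rewrite degF !deg_telt; apply=> i.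
  rewrite kE; have /andP[bi_ge bi_lt] := b_lt i.
  have /andP[b'i_ge b'i_lt] := b'_lt i.
  change (`|b i - b' i| < k i i); lia.
split=> //; subst b'.
pose B := (\prod_i q i ^ `|b i|)%N.
have co_mB : coprimez m B.
  apply: (big_ind (fun x : nat => coprimez m x)) => [|x z mx mz|i _].
  - by rewrite /coprimez gcdz1.
  - by rewrite PoszM coprimezMr mx.
  have PoszX (x c : nat) : (x ^ c)%N%:Z = x%:Z ^+ c by rewrite -!natz natrX.
  rewrite [Posz _]PoszX coprimezXr //; apply: coprimez_dvdr co_mn.
  by rewrite (bigD1 i) //= dvdn_mulr.
have tE : (transversal_elt p y b j / transversal_elt p y b j' =
           a ^^ (B%:Z * (j - j'))%R)%g.
  apply: deg_shift_inj; first by rewrite degF !deg_telt subrr deg_ax.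
  rewrite shiftF ?deg_telt // !shift_telt -mulrBr shift_ax scale_nat => [|i].
    by rewrite rmorphM rmorphB.
  by have /andP[] := b_lt i.
move: Kbb'; rewrite tE aKP Gauss_dvdzr // => /dvdzP[c jj'].
have : `|c| * m < 1 * m by lia.
have m_gt0 : 0 < m by lia.
rewrite ltr_pM2r //; nia.
Qed.

End Transversal.

Lemma star_rowE k l i : star_row p y k l i =
  transversal_elt p y (fun j => if (i <= j)%N then k i j else 0) (l i).
Proof.
congr (_ * _)%g; rewrite big_mkcond; apply: eq_bigr => j _.
by case: ifP.
Qed.

Lemma deg_star_row k l i j :
  deg (star_row p y k l i) j = if (i <= j)%N then k i j else 0.
Proof. by rewrite star_rowE deg_telt. Qed.

Lemma deg_star_subgroup k l m g : star_subgroup k l m g ->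
  exists c : 'I_r -> int, forall j,
    deg g j = \sum_i c i * deg (star_row p y k l i) j.
Proof.
move: g; apply: gen_subgroup_min => [|g].
  split=> [|g h [c gc] [c' hc']].
    by exists 0 => j; rewrite big1 ?deg1 // => i _; apply: mul0r.
  exists (c - c') => j; rewrite degM_at degV_at gc hc' -sumrB.
  by apply: eq_bigr => i _; rewrite -mulrBl.
case=> [[i _ <-]|->]; last first.
  by exists 0 => j; rewrite deg_ax big1 // => i _; apply: mul0r.
exists (fun i' => (i' == i)%:Z) => j;
  rewrite (bigD1 i) //= eqxx mul1r big1 ?addr0 //.
by move=> i' /negbTE ->; rewrite mul0r.
Qed.

(** If the degrees of an element of the lattice vanish before i, so do its
    coefficients on the rows before i, by the triangular shape; the i-th degree
    is then a multiple of the pivot. *)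
Lemma star_minimal_echelon k l m : (forall i, 0 < k i i) ->
  minimal_echelon (star_subgroup k l m) (star_row p y k l).
Proof.
move=> k_gt0; split=> [i|g i /deg_star_subgroup[c gc] g0].
  split=> [|j ji|]; last by rewrite deg_star_row leqnn.
    by apply: sub_gen_subgroup; left; exists i.
  by rewrite deg_star_row leqNgt ji.
have deg_g (j : 'I_r) :
    (forall i : 'I_r, (i < j)%N -> c i = 0) -> deg g j = c j * k j j.
  move=> c0; rewrite gc (bigD1 j) //= deg_star_row leqnn.
  rewrite big1 ?addr0 // => i' i'j.
  rewrite deg_star_row; case: leqP => [i'_le|_]; last by rewrite mulr0.
  by rewrite c0 ?mul0r // ltn_neqAle (inj_eq val_inj) i'j.
have c0 s (j : 'I_r) : (j < s)%N -> (j < i)%N -> c j = 0.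
  elim: s j => // s IHs j; rewrite ltnS => js ji.
  have := g0 j ji; rewrite deg_g => [/eqP|i' i'j].
    by rewrite mulf_eq0 (gt_eqF (k_gt0 j)) orbF => /eqP.
  by apply: IHs; [apply: leq_trans js|apply: ltn_trans ji].
rewrite deg_star_row leqnn deg_g => [|j ji]; last exact: (c0 j.+1).
by rewrite pmulr_lgt0 // => c_gt0; rewrite ler_peMl // ltW.
Qed.

Lemma star_form_transversal (H : set G) k l (m : int) :
  is_subgroup H -> star_form n H k l m ->
  [/\ forall g, exists b j,
        transversal_param k m b j /\ H (transversal_elt p y b j / g)%g
    & forall b b' j j',
        transversal_param k m b j -> transversal_param k m b' j' ->
        H (transversal_elt p y b j / transversal_elt p y b' j')%g ->
        b = b' /\ j = j'].
Proof.
move=> Hsub [HE k_gt0 _ [m_gt0 /eqP co_mn /cap_cycle_aP aHP]].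
have hH : minimal_echelon H (star_row p y k l).
  by rewrite HE; apply: star_minimal_echelon.
have kE i : deg (star_row p y k l i) i = k i i by rewrite deg_star_row leqnn.
split=> [g|b b' j j'].
  by apply: (transversal_exists Hsub kE) => //; [case: hH|rewrite aHP].
exact: (transversal_unique Hsub kE).
Qed.

Lemma star_form_transversal_of (H : set G) k l (m : int) :
  is_subgroup H -> star_form n H k l m ->
  transversal_of H (transversal_set p y k m).
Proof.
move=> Hsub /(star_form_transversal Hsub)[ex uni] g.
have [b [j [bj Hbj]]] := ex g; exists (transversal_elt p y b j); split.
  by split; [exists b, j|apply/mem_right_coset].
move=> _ [[b' [j' [bj' ->]]] /mem_right_coset Hbj'].
have [//|-> -> //] := uni _ _ _ _ bj bj'.
by rewrite -(mulgKA g^-1%g); apply: subgroupF.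
Qed.

(** The parameters of the transversal form a finite type, on which taking the
    coset of the representative is a bijection onto the cosets of [H]. *)
Lemma star_form_index (H : set G) k l (m : int) :
  is_subgroup H -> star_form n H k l m ->
  has_index H `|((\prod_(i < r) k i i) * m)%R|%N.
Proof.
move=> Hsub Hstar; have [ex uni] := star_form_transversal Hsub Hstar.
have [_ k_gt0 _ [m_gt0 _ _]] := Hstar.
pose P := ({dffun forall i : 'I_r, 'I_`|k i i|} * 'I_`|m|)%type.
pose b (x : P) i := (x.1 i : nat)%:Z; pose j (x : P) := (x.2 : nat)%:Z.
pose f x := right_coset H (transversal_elt p y (b x) (j x)).
have param x : transversal_param k m (b x) (j x).
  rewrite /b /j; split=> [i|] /=.
    by have := ltn_ord (x.1 i); have := k_gt0 i; lia.
  by have := ltn_ord x.2; lia.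
have f_inj : {in [set: P] &, injective f}.
  move=> x x' _ _ xx'.
  have : f x' (transversal_elt p y (b x) (j x)).
    by rewrite -xx'; apply/mem_right_coset; rewrite mulgV; apply: subgroup1.
  move=> /mem_right_coset/(uni _ _ _ _ (param x) (param x'))[x1 [x2]].
  case: x x' x1 x2 {xx'} => [x1 x2] [x1' x2'] /= e1 e2.
  congr (_, _); last exact: val_inj.
  by apply/ffunP => i; apply/val_inj; have [] := congr1 (@^~ i) e1.
rewrite /has_index; have -> : right_cosets H = [set f x | x in [set: P]].
  rewrite eqEsubset; split=> [_ [g _ <-]|_ [x _ <-]]; last by eexists.
  have [c [d [[c_lt d_lt] Hcd]]] := ex g.
  have ci i : (`|c i| < `|k i i|)%N by have := c_lt i; lia.
  have dm : (`|d| < `|m|)%N by lia.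
  exists ([ffun i => Ordinal (ci i)], Ordinal dm) => //.
  apply: right_coset_eq => //; rewrite /f /b /j /=.
  congr (H (transversal_elt p y _ _ / _)%g): Hcd; last by lia.
  by apply/funext => i; rewrite ffunE /=; have := c_lt i; lia.
apply: card_eq_trans (inj_card_eq f_inj) _.
have <- : #|{: P}| = `|((\prod_(i < r) k i i) * m)%R|%N.
  rewrite card_prod card_ord abszM; congr (_ * _)%N.
  rewrite card_dep_ffun foldrE big_image (big_morph _ abszM absz1).
  by apply: eq_bigr => i _; rewrite card_ord.
have rankT : [set enum_rank x | x in [set: P]] = [set: 'I_#|{: P}|].
  by rewrite eqEsubset; split=> // i _; exists (enum_val i); rewrite ?enum_valK.
apply: card_esym; apply: card_eq_trans card_II _.
rewrite -rankT; apply: inj_card_eq => x x' _ _; exact: enum_rank_inj.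
Qed.

(** * Generators of a subgroup of finite index *)

Section FiniteIndex.
Variable H : set G.
Hypotheses (Hsub : is_subgroup H) (Hfin : finite_index H).

Lemma finite_index_unbounded : deg_unbounded H.
Proof.
move=> k.
have [e e_gt0 He] := finite_index_exp Hsub (tpow (fun=> k%:Z)) Hfin.
exists (tpow (fun=> k%:Z) ^+ e)%g => // i.
have := deg_expgz (tpow (fun=> k%:Z)) e i; rewrite /= => ->.
by rewrite deg_tpow; nia.
Qed.

Lemma finite_index_cycle_a : exists2 m : int, 0 < m &
  forall c : int, H (a ^^ c)%g <-> (m %| c)%Z.
Proof.
have exm : exists e : nat, (0 < e)%N && `[< H (a ^+ e)%g >].
  have [e e_gt0 He] := finite_index_exp Hsub a Hfin.
  by exists e; rewrite e_gt0; apply/asboolP.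
have [m /andP[m_gt0 /asboolP Hm] m_min] := ex_minnP exm.
exists m => // c; split=> [Hc|/dvdzP[e ->]]; last first.
  by rewrite mulrC -expgz_a_mul; apply: subgroup_expgz.
have : H (a ^^ (c %% m)%Z)%g.
  have -> : (c %% m)%Z = c - m%:Z * (c %/ m)%Z by rewrite mulrC.
  rewrite expgzD expgzN; apply: subgroupF => //.
  by rewrite -expgz_a_mul; apply: subgroup_expgz.
have := ltz_pmod c (m_gt0 : 0 < m%:Z).
have : 0 <= (c %% m)%Z by rewrite modz_ge0 // gt_eqF.
rewrite (sameP dvdz_mod0P eqP); case: (c %% m)%Z => // -[//|s] _ s_lt Hs.
have /m_min : (0 < s.+1)%N && `[< H (a ^+ s.+1)%g >] by apply/asboolP.
by rewrite leqNgt; case/negP.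
Qed.

(** Take w in H with positive degrees and let z = gcd(m, n). As n divides
    q^deg w, so does z, and w conjugates a^(m / z) to a power of a^m; hence
    a^(m / z) is in H and m divides m / z. *)
Lemma finite_index_coprime (m : int) : 0 < m ->
  (forall c : int, H (a ^^ c)%g <-> (m %| c)%Z) -> coprimez m n%:Z.
Proof.
move=> m_gt0 aHP; have [w Hw w_ge1] := finite_index_unbounded 1.
pose B := (\prod_i q i ^ `|deg w i|)%N.
have nB : (n %| B)%N.
  apply: (big_ind2 (fun x z : nat => (x %| z)%N)) => // [x x' z z'|i _].
    exact: dvdn_mul.
  by have := w_ge1 i; case: (deg w i) => [[|s]|s] // _; rewrite expnS dvdn_mulr.
have /dvdzP[m' mE] := dvdz_gcdl m n.
have /dvdzP[s BE] : (gcdz m n %| B%:Z)%Z by apply: (dvdz_trans (dvdz_gcdr m n)).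
have wa : (w * a ^^ m' = a ^^ (m * s)%R * w)%g.
  apply: deg_shift_inj; first by rewrite !degM !deg_ax addr0 add0r.
  rewrite !shiftM !deg_ax scale0 mul1r !shift_ax addrC; congr (_ + _).
  rewrite scale_nat => [|i]; last by apply: le_trans (w_ge1 i).
  rewrite -[_%:R]/(B%:Z%:~R) -rmorphM; congr (_%:~R).
  have -> : m * s = m' * gcdz m n * s by rewrite -mE.
  by rewrite BE; ring.
have : H (a ^^ m')%g.
  rewrite -(mulKg w (a ^^ m')%g) wa; apply: (subgroupM Hsub);
    first exact: subgroupV.
  by apply: (subgroupM Hsub) => //; rewrite aHP dvdz_mulr.
rewrite aHP => /dvdzP[e m'E]; rewrite /coprimez; set z := gcdz m n in mE *.
have : (z %| 1)%Z.
  apply/dvdzP; exists e; apply: (mulIf (lt0r_neq0 m_gt0)).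
  by rewrite mul1r {1}mE m'E mulrAC.
by rewrite dvdz1.
Qed.

Lemma finite_index_echelon : exists h : 'I_r -> G, minimal_echelon H h.
Proof.
pose pivot (i : 'I_r) g :=
  [/\ H g, forall j : 'I_r, (j < i)%N -> deg g j = 0 & 0 < deg g i].
have /choice[h hP] i :
    exists h, pivot i h /\ forall g, pivot i g -> deg h i <= deg g i.
  have expiv : exists e : nat, `[< exists2 g, pivot i g & deg g i = e >].
    have [e e_gt0 He] := finite_index_exp Hsub (t i) Hfin.
    have degt j : deg (t i ^+ e)%g j = e%:Z * (j == i)%:Z.
      by have := deg_expgz (t i) e j; rewrite deg_t.
    exists e; apply/asboolP; exists (t i ^+ e)%g;
      last by rewrite degt eqxx mulr1.
    split=> // [j ji|]; rewrite degt ?eqxx ?mulr1 //.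
    by rewrite -(inj_eq val_inj) /= ltn_eqF ?mulr0.
  have [e /asboolP[h hi he] e_min] := ex_minnP expiv.
  exists h; split=> // g gi; have [_ _ g_gt0] := gi.
  rewrite he -[deg g i]gtz0_abs //.
  by apply: e_min; apply/asboolP; exists g; rewrite // gtz0_abs.
exists h; split=> [i|g i Hg g0 g_gt0]; have [hi hmin] := hP i; first exact: hi.
exact: hmin.
Qed.

(** The rows are pivot elements reduced by the later rows; multiplying them by
    elements of m Z[1/n], which is contained in H, gives them the shape
    t^d a^l. They generate H together with a^m, because the representative in H
    of a coset of the generated subgroup can only be the identity. *)
Lemma finite_index_star_form : exists k l m, star_form n H k l m.
Proof.
have [m m_gt0 aHP] := finite_index_cycle_a.
have co_mn := finite_index_coprime m_gt0 aHP.
have Ham : H (a ^^ m)%g by rewrite aHP.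
have [h [hH hmin]] := finite_index_echelon.
have /choice[f fP] (i : 'I_r) : exists f : G,
    [/\ H f, forall j : 'I_r, (j < i)%N -> deg f j = 0, deg f i = deg (h i) i
      & forall j : 'I_r, (i < j)%N -> 0 <= deg f j < deg (h j) j].
  have [w [Hw w0 wr]] := echelon_reduce (h i) i.+1 Hsub hH.
  have [Hh h0 _] := hH i; exists (w * h i)%g; split=> // [|j ji|].
  - exact: subgroupM.
  - by rewrite degM_at w0 ?h0 // ltnW.
  by rewrite degM_at w0 ?add0r.
have /choice[l lP] i := residue (f i) m_gt0 co_mn.
pose k i j := deg (f i) j.
have rowE i : star_row p y k l i = transversal_elt p y (deg (f i)) (l i).
  rewrite star_rowE; congr transversal_elt; apply/funext => j.
  by case: leqP => // ji; have [_ f0 _ _] := fP i; rewrite f0.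
have Hrow i : H (star_row p y k l i).
  have [Hf _ _ _] := fP i.
  rewrite rowE -(mulgVK (f i) (transversal_elt _ _ _ _)).
  apply: subgroupM => //; have [_] := lP i.
  exact: Zinv_multiples_sub Ham finite_index_unbounded _.
have k_gt0 i : 0 < k i i.
  by have [_ _ h_gt0] := hH i; have [_ _ f_h _] := fP i; rewrite /k f_h.
have kE i : deg (star_row p y k l i) i = k i i by rewrite deg_star_row leqnn.
have rowH : minimal_echelon H (star_row p y k l).
  split=> [i|g i Hg g0 g_gt0].
    by split=> // [j ji|]; rewrite deg_star_row ?leqnn // leqNgt ji.
  by rewrite kE /k; have [_ _ -> _] := fP i; apply: hmin.
pose K : set G := star_subgroup k l m.
have Ksub : is_subgroup K by apply: gen_subgroupP.
have [Krow _] : minimal_echelon K (star_row p y k l).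
  exact: star_minimal_echelon.
have Kam : K (a ^^ m)%g by apply: sub_gen_subgroup; right.
have KH : K `<=` H by apply: gen_subgroup_min => // _ [[i _ <-]|->].
have HK : H `<=` K.
  move=> g Hg; have [b [j [bj Kbj]]] :=
    transversal_exists Ksub kE co_mn g Krow m_gt0 Kam.
  (* The identity is the representative with parameters 0. *)
  have tE0 : transversal_elt p y 0 0 = 1%g :> G.
    by rewrite [LHS]mulg1; apply: tpow0.
  have [||b0 j0] :=
    transversal_unique Hsub kE co_mn (b' := 0) (j' := 0) rowH aHP bj.
  - by split=> [i|]; rewrite lexx /=; first exact: k_gt0.
  - rewrite tE0 divg1 -(mulgVK g (transversal_elt _ _ _ _)).
    by apply: subgroupM => //; apply: KH.
  move: Kbj; rewrite b0 j0 tE0 div1g => /(subgroupV Ksub).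
  by rewrite invgK.
exists k, l, m; split=> //.
- by rewrite eqEsubset; split.
- move=> i j ij; have [_ _ kjj _] := fP j; have [_ _ _ /(_ j ij)] := fP i.
  by rewrite /k kjj.
by split=> //; [exact/eqP|exact/cap_cycle_aP].
Qed.

End FiniteIndex.

End SolvableBS.

Theorem theorem3p4 (n r : nat) (p y : 'I_r -> nat)
    (hn : (2 <= n)%N)
    (hp : forall i, prime (p i))
    (hpinj : injective p)
    (hy : forall i, (0 < y i)%N)
    (hnp : n = (\prod_(i < r) p i ^ y i)%N) :
  (forall H : set (Gamma p y), is_subgroup H -> finite_index H ->
     exists (k : 'I_r -> 'I_r -> int) (l : 'I_r -> int) (m : int),
       star_form n H k l m)
  /\
  (forall (H : set (Gamma p y))
      (k : 'I_r -> 'I_r -> int) (l : 'I_r -> int) (m : int),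
     is_subgroup H -> star_form n H k l m ->
     [/\ transversal_of H (transversal_set p y k m),
         forall (b b' : 'I_r -> int) (j j' : int),
           transversal_param k m b j -> transversal_param k m b' j' ->
           transversal_elt p y b j = transversal_elt p y b' j' ->
           b = b' /\ j = j',
         has_index H `|((\prod_(i < r) k i i) * m)%R|%N
       & finite_index H]).
Proof.
rewrite hnp.
have q_gt0 i : (0 < p i ^ y i)%N by rewrite expn_gt0 prime_gt0.
split=> [H Hsub Hfin|H k l m Hsub Hstar].
  exact: finite_index_star_form.
have Hindex := star_form_index q_gt0 Hsub Hstar.
have [_ uni] := star_form_transversal q_gt0 Hsub Hstar.
split=> //.
- exact: star_form_transversal_of Hsub Hstar.
- move=> b b' j j' bj bj' eq_elt; apply: uni bj bj' _.
  by rewrite eq_elt mulgV; apply: subgroup1.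
by apply/finite_setP; exists `|((\prod_(i < r) k i i) * m)%R|%N.
Qed.
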